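(* Let $U$ be a set with at least two elements and let $\pi,\sigma$ be partitions on $U$ with $\operatorname{dit}(\pi)\neq\emptyset$ and $\operatorname{dit}(\sigma)\neq\emptyset$. Then $\operatorname{dit}(\pi)\cap\operatorname{dit}(\sigma)\neq\emptyset$.
   Context: A partition on $U$ is a set of nonempty, pairwise disjoint subsets of $U$ (blocks) whose union is $U$. For a partition $\pi$, $\operatorname{dit}(\pi)\subseteq U\times U$ is the set of ordered pairs $(u,u')$ with $u,u'$ in different blocks of $\pi$. *)

(* Defs.v *)
From mathcomp Require Import all_boot.
From mathcomp Require Import boolp classical_sets.
Set Implicit Arguments.
Unset Strict Implicit.
Unset Printing Implicit Defensive.
Local Open Scope classical_set_scope.

(* The library's [partition] is about indexed families; a set of blocks is the
   family indexed by itself through the identity. *)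
Definition is_partition (U : Type) (pi : set (set U)) : Prop :=
  partition pi id [set: U].

Definition dit (U : Type) (pi : set (set U)) : set (U * U) :=
  [set p | exists B B' : set U,
     [/\ pi B, pi B', B <> B', B p.1 & B' p.2]].

(* Main.v *)
(** A partition separating two points separates every third point from one of
    them.  Starting from [(a, b)] in [dit pi], this gives an [e] with [(a, e)] in
    [dit sigma]; a pair common to both sets is then found among the pairs of
    [{a, b, e}]. *)
Require Import Defs.
From mathcomp Require Import all_boot.
From mathcomp Require Import boolp classical_sets.
Local Open Scope classical_set_scope.

Lemma dit_sym (U : Type) (pi : set (set U)) (u v : U) :
  dit pi (u, v) -> dit pi (v, u).
Proof.
by move=> [B [B' [piB piB' neq Bu B'v]]]; exists B', B; split=> // /esym.
Qed.

(** The block [C] covering [v] cannot equal both [B] and [B'], as these differ. *)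
Lemma dit_cotrans (U : Type) (pi : set (set U)) (u v w : U) :
  is_partition pi -> dit pi (u, w) -> dit pi (u, v) \/ dit pi (v, w).
Proof.
move=> [cov _ _] [B [B' [piB piB' neq Bu B'w]]].
have [C piC Cv] : cover pi id v by rewrite cov.
have [eqBC|neqBC] := pselect (B = C).
- by right; exists C, B'; split=> //; rewrite -eqBC.
- by left; exists B, C.
Qed.

Theorem mainTheorem2 (U : Type) (hU : exists u v : U, u <> v)
    (pi sigma : set (set U))
    (hpi : is_partition pi) (hsigma : is_partition sigma)
    (hdpi : dit pi <> set0) (hdsigma : dit sigma <> set0) :
  dit pi `&` dit sigma <> set0.
Proof.
move/eqP/set0P: hdpi => [[a b] pi_ab].
move/eqP/set0P: hdsigma => [[c d] sigma_cd].
(* The third point [a] is compared with the pair [(c, d)], so [e] is [c] or [d]. *)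
have [e sigma_ae] : exists e, dit sigma (a, e).
  case: (dit_cotrans _ _ _ a _ hsigma sigma_cd) => [sigma_ca|sigma_ad].
  - by exists c; apply: dit_sym.
  - by exists d.
apply/eqP/set0P.
case: (dit_cotrans _ _ _ e _ hpi pi_ab) => [pi_ae|pi_eb].
  by exists (a, e).
have pi_be := dit_sym _ _ _ _ pi_eb.
(* Now [pi] separates [b] from both [a] and [e], while [sigma], separating [a] from [e], must
   separate [b] from one of them. *)
case: (dit_cotrans _ _ _ b _ hsigma sigma_ae) => [sigma_ab|sigma_be].
- by exists (a, b).
- by exists (b, e).
Qed.
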